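(* Let $G=(V,E,F)$ be an oriented graph on a surface and let $k$ be a positive integer. Then $(-1)^{|E|-|F|+c(G)}\,\tau^{loc}(G;-k)$ is equal to the number of pairs $(t,\mathfrak{o})$ where $t$ is a local $\mathbb{Z}_k$-tension on $G$ and $\mathfrak{o}$ is a boundary acyclic orientation of $G\mathbin{\backslash\!\backslash}\operatorname{supp}(t)$.
   Context: Graphs may have loops and multiple edges. A graph on a surface $G=(V,E,F)$ is a graph $(V,E)$ cellularly embedded in a closed oriented (not necessarily connected) surface $\Sigma$, i.e. $\Sigma\setminus G$ is a disjoint union of discs, the faces, forming the set $F$; $c(G)$ is the number of connected components of $\Sigma$. Equivalently $G$ is an orientable ribbon graph: a surface with boundary that is a union of vertex discs and edge discs (each edge disc meeting the vertex discs in exactly two disjoint segments); capping each boundary component by a disc (a face) gives $\Sigma$. An oriented graph on a surface is one with a fixed orientation $\sigma$ of its edges. Boundary: for $F'\subseteq F$, $\partial F'$ is the set of edges having two distinct adjacent faces exactly one of which belongs to $F'$. Each edge of $\partial F'$ has a natural direction, giving $\overrightarrow{\partial F'}$: the direction induced by the orientation of its adjacent face $f\in F'$ as a submanifold of $\Sigma$. For an orientation $\mathfrak{o}$, $\overrightarrow{\partial_{\mathfrak{o}}F'}\in\{0,\pm1\}^E$ has $e$-entry $0$ if $e\notin\partial F'$, $1$ if the direction of $e$ in $\overrightarrow{\partial F'}$ agrees with $\mathfrak{o}$, $-1$ if it disagrees. Write $\overrightarrow{\partial_{\mathfrak{o}}f}$ when $F'=\{f\}$. A nonempty boundary $\partial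 F'$ is coherently oriented with respect to $\mathfrak{o}$ if the nonzero entries of $\overrightarrow{\partial_{\mathfrak{o}}F'}$ are all $+1$ or all $-1$. A boundary acyclic orientation is an orientation with no coherently oriented (nonempty) boundary. Local tensions: a local $\mathbb{Z}_k$-tension is a map $t:E\to\mathbb{Z}_k=\mathbb{Z}/k\mathbb{Z}$ with $\sum_{e\in\partial f}\overrightarrow{\partial_\sigma f}(e)\,t(e)=0$ for every face $f$; $\operatorname{supp}(t)=\{e:t(e)\ne0\}$. For positive integers $k$, $\tau^{loc}(G;k)$ is the number of nowhere-zero local $\mathbb{Z}_k$-tensions (those with $\operatorname{supp}(t)=E$). It is a polynomial in $k$ (the local tension polynomial), and $\tau^{loc}(G;-k)$ is the value of this polynomial at $-k$. Deletion and contraction (as ribbon graphs): $G\setminus e$ deletes the edge disc $e$. For a non-loop $e$ with ends $v,w$, $G/e$ replaces $e,v,w$ by the single vertex disc $e\cup v\cup w$. For a loop $e$ at $v$, $e\cup v$ is an annulus, and $G/e$ replaces $e$ and $v$ by two new vertex discs bounded by the two boundary circles of $e\cup v$. These operations may change the surface $\Sigma$. The operation $\mathbin{\backslash\!\backslash}$: an edge is a coloop if the same face lies on both of its sides (equivalently, its dual edge is a loop of the dual graph). For $A=\{e_1,\dots,e_l\}\subseteq E$, $G\mathbin{\backslash\!\backslash}A$ is obtained from $G$ by processing $e_1,\dots,e_l$ successively, deleting $e_i$ if it is not a coloop of the current graph on a surface and contracting $e_i$ (as a ribbon graph) if it is a coloop. *)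

(* Defs.v *)
From HB Require Import structures.
From mathcomp Require Import all_boot all_order all_fingroup all_algebra.

Set Implicit Arguments.
Unset Strict Implicit.
Unset Printing Implicit Defensive.

Import Order.TTheory GRing.Theory Num.Theory.
Local Open Scope ring_scope.

(* A graph cellularly embedded in a closed oriented surface is encoded by its
   rotation system.  The half-edges of an edge e are the darts (e, true) and
   (e, false); the dart (e, b) also stands for e directed away from the vertex
   carrying (e, b).  Which of the two darts is called "true" has no meaning. *)

Notation dart E := (E * bool)%type.

Section Darts.
Variable E : finType.

Definition opp (d : dart E) : dart E := (d.1, ~~ d.2).

Lemma oppK : involutive opp.
Proof. by case=> e b; rewrite /opp /= negbK. Qed.

Definition opp_perm : {perm dart E} := perm (inv_inj oppK).

Definition darts_of (A : {set E}) : {set dart E} := [set d | d.1 \in A].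

(* [rg_node d] is the half-edge following d counterclockwise around its vertex.
   The vertices are the cycles of [rg_node] on the darts of [rg_edges], together
   with [rg_isolated] vertices without half-edges; each of the latter lies on a
   sphere of its own, with a single face.  Keeping the edge set inside a fixed
   type E lets deletion and contraction stay in the same type. *)
Record ribbon_graph := RibbonGraph {
  rg_edges : {set E};
  rg_node : {perm dart E};
  rg_isolated : nat;
  rg_node_on : perm_on (darts_of rg_edges) rg_node
}.

End Darts.

Notation edge G := {e | e \in rg_edges G}.

(* The edge e is directed along the dart (e, o e). *)
Notation orientation G := {ffun edge G -> bool}.

Notation face G := ({set dart _} + 'I_(rg_isolated G))%type.

Section Faces.
Variables (E : finType) (G : ribbon_graph E).

(* Following the dart d with its left side at hand, one arrives through [opp d]
   and leaves through the next half-edge clockwise.  A cycle of this permutation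
   is a face, traversed in the direction induced on its boundary, and
   consists of the darts having that face on their left. *)
Definition face_perm : {perm dart E} := (opp_perm E * (rg_node G)^-1)%g.

Definition left_face (d : dart E) : face G := inl (porbit face_perm d).

Definition faces : {set face G} :=
  [set left_face d | d in darts_of (rg_edges G)]
    :|: [set (inr i : face G) | i : 'I_(rg_isolated G)].

Definition coloop (e : E) : bool :=
  left_face (e, true) == left_face (e, false).

Definition same_vertex_or_edge : rel (dart E) :=
  [rel x y | (y \in porbit (rg_node G) x) || (y.1 == x.1)].

Definition ncomponents : nat :=
  (n_comp same_vertex_or_edge (darts_of (rg_edges G)) + rg_isolated G)%N.

Definition boundary (F' : {set face G}) : {set edge G} :=
  [set e : edge G | ~~ coloop (val e) &&
    ((left_face (val e, true) \in F') (+) (left_face (val e, false) \in F'))].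

Definition boundary_vector (o : orientation G) (F' : {set face G}) (e : edge G)
    : int :=
  if e \notin boundary F' then 0
  else if left_face (val e, o e) \in F' then 1 else -1.

Definition coherently_oriented (o : orientation G) (F' : {set face G}) : bool :=
  [forall e in boundary F', boundary_vector o F' e == 1]
  || [forall e in boundary F', boundary_vector o F' e == -1].

Definition boundary_acyclic (o : orientation G) : bool :=
  [forall F' : {set face G},
    (F' \subset faces) && (boundary F' != set0) ==>
      ~~ coherently_oriented o F'].

Definition local_tension (M : finZmodType) (sigma : orientation G)
    (t : {ffun edge G -> M}) : bool :=
  [forall f in faces,
    \sum_(e in boundary [set f]) t e *~ boundary_vector sigma [set f] e == 0].

Definition supp (M : finZmodType) (t : {ffun edge G -> M}) : {set E} :=
  [set val e | e : edge G & t e != 0].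

End Faces.

(* The group Z/kZ for k > 0; 'Z_k would be wrong for k = 1. *)
Notation residue k := 'I_k.-1.+1.

Section Operations.
Variable E : finType.
Implicit Types (G : ribbon_graph E) (s : {perm dart E}) (d : dart E) (e : E).

(* Takes d out of its cycle, leaving it fixed. *)
Definition skip s d : {perm dart E} := (s * tperm d (s d))%g.

Definition skip_edge s e : {perm dart E} :=
  skip (skip s (e, true)) (e, false).

Lemma skip_self s d : skip s d d = d.
Proof. by rewrite permM tpermR. Qed.

Lemma skip_fix s d d' : s d' = d' -> skip s d d' = d'.
Proof.
move=> sd'; have [->|nd] := eqVneq d' d; first exact: skip_self.
rewrite permM sd' tpermD //; first by rewrite eq_sym.
by apply: contra_neq nd => sdd'; apply: (@perm_inj _ s); rewrite sd' sdd'.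
Qed.

Lemma skip_edge_on s (A : {set E}) e :
  perm_on (darts_of (e |: A)) s -> perm_on (darts_of (A :\ e)) (skip_edge s e).
Proof.
move=> sA; apply/subsetP=> -[x b]; rewrite !inE /=; apply: contraR.
have [->|xe] /= := eqVneq x e => [_ | xA].
  by case: b; apply/eqP; rewrite /skip_edge ?skip_self // skip_fix ?skip_self.
apply/eqP; do 2!apply: skip_fix; apply: (out_perm sA).
by rewrite !inE /= negb_or xe.
Qed.

(* Removes e when the cycles of s are the vertices; a vertex all of whose
   half-edges belong to e becomes isolated. *)
Definition remove_edge G s e
    (s_on : perm_on (darts_of (e |: rg_edges G)) s) : ribbon_graph E :=
  RibbonGraph
    (rg_isolated G +
      #|[set v in [set porbit s d | d in darts_of [set e]]
          | v \subset darts_of [set e]]|)%N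
    (skip_edge_on s_on).

Lemma node_on_setU1 G e : perm_on (darts_of (e |: rg_edges G)) (rg_node G).
Proof.
apply: subset_trans (rg_node_on G) _.
by apply/subsetP=> d; rewrite !inE => ->; rewrite orbT.
Qed.

Definition delete G e : ribbon_graph E := remove_edge (node_on_setU1 G e).

(* Composing with the transposition of the two half-edges d, d' of e turns the
   cycles (d A) and (d' B) at the ends of a non-loop into (d B d' A), and the
   cycle (d A d' B) at a loop into (d B) and (d' A).  Skipping d and d' leaves
   (A B), read off the boundary of the disc formed by e and its ends, or (A) and
   (B), read off the boundary circles of the annulus formed by e and its end. *)
Definition contract_node G e : {perm dart E} :=
  (tperm (e, true) (e, false) * rg_node G)%g.

Lemma contract_node_on G e :
  perm_on (darts_of (e |: rg_edges G)) (contract_node G e).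
Proof.
apply/subsetP=> -[x b]; rewrite !inE /=; apply: contraR.
rewrite negb_or => /andP[xe xG]; rewrite permM tpermD.
- by apply/eqP/(out_perm (rg_node_on G)); rewrite inE.
- by apply: contraNneq xe => -[->].
- by apply: contraNneq xe => -[->].
Qed.

Definition contract G e : ribbon_graph E := remove_edge (contract_node_on G e).

(* G \\ A, where s lists the elements of A in the order of processing. *)
Definition delete_contract G (s : seq E) : ribbon_graph E :=
  foldl (fun H e => if coloop H e then contract H e else delete H e) G s.

End Operations.

Definition num_nowhere_zero_tensions (E : finType) (G : ribbon_graph E)
    (sigma : orientation G) (k : nat) : nat :=
  #|[set t : {ffun edge G -> residue k}
      | local_tension sigma t & supp t == rg_edges G]|.

Definition local_tension_polynomial (E : finType) (G : ribbon_graph E)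
    (sigma : orientation G) (p : {poly rat}) : Prop :=
  forall k : nat, (0 < k)%N ->
    p.[k%:R] = (num_nowhere_zero_tensions sigma k)%:R.

(* [order] says in which order the elements of each support are processed. *)
Definition num_tension_orientation_pairs (E : finType) (G : ribbon_graph E)
    (sigma : orientation G) (order : {set E} -> seq E) (k : nat) : nat :=
  #|[set p : {t : {ffun edge G -> residue k}
               & orientation (delete_contract G (order (supp t)))}
      | local_tension sigma (tag p) & boundary_acyclic (tagged p)]|.

(* Main.v *)
Require Import Defs.
From HB Require Import structures.
From mathcomp Require Import all_boot all_order all_fingroup all_algebra.
From mathcomp Require Import ring zify.

(** In the dual graph, whose vertices are the faces, local tensions are flows,
    boundaries are cuts, coloops are loops and boundary acyclic orientations are
    totally cyclic ones; deleting a non-coloop contracts its dual edge, and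
    contracting a coloop deletes a dual loop, which is again a contraction.  The
    statement is thus Breuer and Sanyal's reciprocity theorem for the flow
    polynomial, proved by deletion and contraction.

    Neither vertices nor quotients are needed: the dual graph is represented by
    the field Q of all sets of darts that are unions of faces, that is, by the
    sets of dual vertices, and the contraction of B by the members of Q in which no edge of B
    has exactly one of its darts. *)

Set Implicit Arguments.
Unset Strict Implicit.
Unset Printing Implicit Defensive.

Import Order.TTheory GRing.Theory Num.Theory.
Local Open Scope ring_scope.

(** * Sums over subsets *)

Section SubsetSums.
Variable T : finType.
Implicit Types (A B : {set T}) (x : T).

Lemma sum_subsets_setU1 A x (F : {set T} -> nat) : x \notin A ->
  (\sum_(B in powerset (x |: A)) F B
   = \sum_(B in powerset A) (F B + F (x |: B)))%N.
Proof.
move=> xA; rewrite big_split /= (bigID (fun B => x \in B)) /= addnC.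
have subP B : B \subset A -> x \notin B by move=> sBA; apply: contra xA => /(subsetP sBA).
congr (_ + _)%N.
  apply: eq_bigl => B; rewrite !powersetE.
  apply/andP/idP => [[/subsetP sBA xB] | sBA].
    apply/subsetP => y yB; have := sBA y yB; rewrite !inE.
    by case/orP=> // /eqP eyx; rewrite -eyx yB in xB.
  by split; [apply: subset_trans sBA (subsetUr _ _) | apply: subP].
rewrite (reindex_onto (fun B => x |: B) (fun B => B :\ x)) /=; last first.
  by move=> B /andP[_ xB]; rewrite setD1K.
apply: eq_bigl => B; rewrite !powersetE setU11 andbT.
apply/andP/idP => [[sBA /eqP defB] | sBA].
  by rewrite -defB subDset.
split; first exact: setUS.
by rewrite setU1K ?subP.
Qed.

End SubsetSums.

(** * Cuts and contractions in a field of dart sets *)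

Section CutFields.
Variable E : finType.
Implicit Types (X Y : {set dart E}) (Q : {set {set dart E}}) (e f : E).
Implicit Types (L S B o : {set E}).

(** For [X] in the field, this says that the dual edge of [e] belongs to the cut around the vertex
    set [X]. *)
Definition crosses X e := ((e, true) \in X) (+) ((e, false) \in X).

Definition uncrossed Q B := [set X in Q | [forall e in B, ~~ crosses X e]].

Definition set_field Q :=
  {in Q &, forall X Y, X :|: Y \in Q} /\ {in Q, forall X, ~: X \in Q}.

Lemma uncrossedP Q B X :
  reflect (X \in Q /\ {in B, forall e, ~~ crosses X e}) (X \in uncrossed Q B).
Proof. by rewrite inE; apply: (iffP andP) => -[XQ /'forall_implyP]. Qed.

Lemma uncrossed0 Q : uncrossed Q set0 = Q.
Proof. by apply/setP=> X; apply/uncrossedP/idP => [[]|XQ] //; split=> // e; rewrite inE. Qed.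

Lemma uncrossedU Q A B : uncrossed (uncrossed Q A) B = uncrossed Q (A :|: B).
Proof.
apply/setP=> X; apply/uncrossedP/uncrossedP => [[/uncrossedP[XQ XA] XB] | [XQ XAB]].
  by split=> // e /setUP[/XA | /XB].
split; last by move=> e eB; apply: XAB; rewrite inE eB orbT.
by apply/uncrossedP; split=> // e eA; apply: XAB; rewrite inE eA.
Qed.

Lemma uncrossed_id Q B :
  {in Q, forall X, {in B, forall e, ~~ crosses X e}} -> uncrossed Q B = Q.
Proof.
by move=> QB; apply/setP=> X; apply/uncrossedP/idP => [[]|XQ] //; split=> //; apply: QB.
Qed.

Lemma set_fieldI Q : set_field Q -> {in Q &, forall X Y, X :&: Y \in Q}.
Proof.
case=> QU QC X Y XQ YQ.
by rewrite -[X :&: Y]setCK setCI; apply/QC/QU; apply: QC.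
Qed.

Lemma crossesC X e : crosses (~: X) e = crosses X e.
Proof. by rewrite /crosses !inE addbN addNb negbK. Qed.

Lemma uncrossed_set_field Q B : set_field Q -> set_field (uncrossed Q B).
Proof.
case=> QU QC; split=> [X Y | X].
  move=> /uncrossedP[XQ XB] /uncrossedP[YQ YB]; apply/uncrossedP.
  split=> [|e eB]; first exact: QU.
  by move: (XB e eB) (YB e eB); rewrite /crosses !inE; do 4!case: (_ \in _).
move=> /uncrossedP[XQ XB]; apply/uncrossedP; split=> [|e eB]; first exact: QC.
by rewrite crossesC XB.
Qed.

Lemma crossing_set Q X e b : set_field Q -> X \in Q -> crosses X e ->
  exists2 Y, Y \in Q & ((e, b) \in Y) && ((e, ~~ b) \notin Y)
    /\ forall f, crosses Y f = crosses X f.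
Proof.
move=> [_ QC] XQ Xe; have [Xb | Xb] := boolP ((e, b) \in X).
  by exists X; rewrite // Xb; move: Xe Xb; rewrite /crosses; case: b => /=;
     do 2!case: (_ \in _).
exists (~: X); first exact: QC.
split; last exact: crossesC.
by rewrite !inE Xb; move: Xe Xb; rewrite /crosses; case: b => /=; do 2!case: (_ \in _).
Qed.

(** Symmetric difference with [X] is an involution of [Q] that toggles crossing by [e]. In the dual
    graph, contracting a non-loop merges two vertices into one. *)
Lemma card_uncrossed1 Q e X : set_field Q -> X \in Q -> crosses X e ->
  (#|Q| = 2 * #|uncrossed Q [set e]|)%N.
Proof.
move=> fQ XQ Xe; have [QU QC] := fQ; have QI := set_fieldI fQ.
pose g Y := (X :\: Y) :|: (Y :\: X).
have gQ Y : Y \in Q -> g Y \in Q.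
  by move=> YQ; apply: QU; rewrite setDE; apply: QI => //; apply: QC.
have gK : involutive g.
  by move=> Y; apply/setP=> d; rewrite !inE; do 2!case: (_ \in _).
have g_crosses Y : crosses (g Y) e = ~~ crosses Y e.
  by move: Xe; rewrite /crosses !inE; do 4!case: (_ \in _).
rewrite -(cardsID (uncrossed Q [set e]) Q) mul2n -addnn.
have sub : uncrossed Q [set e] \subset Q by apply/subsetP=> Y /uncrossedP[].
rewrite (setIidPr sub); congr (_ + _)%N.
rewrite -(card_imset _ (can_inj gK)); apply/esym/eq_card => Y.
have inU Z : (Z \in uncrossed Q [set e]) = (Z \in Q) && ~~ crosses Z e.
  apply/uncrossedP/andP => -[ZQ Ze]; split=> //; first by apply: Ze; rewrite inE.
  by move=> f; rewrite inE => /eqP->.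
rewrite inU; apply/andP/imsetP => [[YQ Ye] | [Z]].
  by exists (g Y); rewrite ?gK // in_setD inU gQ //= g_crosses Ye.
by rewrite in_setD inU => /andP[nZ ZQ] ->; move: nZ; rewrite gQ ?ZQ //= g_crosses.
Qed.

(** * Flows with prescribed support *)

Section Flows.
Variable M : finZmodType.
Implicit Types t : {ffun E -> M}.

(** The dual edge of [e] leads from the face at [(e, true)] to the face at [(e, false)], so that
    this is the signed incidence vector of a cut and [flux] is the net flow out of [X]. *)
Definition coboundary X e : int :=
  ((e, true) \in X)%:R - ((e, false) \in X)%:R.

Definition flux t X := \sum_e t e *~ coboundary X e.

Definition fsupp t := [set e | t e != 0].

(** Conservation at all members of a field of sets amounts to conservation at its atoms, the dual
    vertices. The support is exactly [S], so that [flows Q L] consists of the nowhere-zero flows on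
    [L]. *)
Definition flows Q S :=
  [set t | (fsupp t == S) && [forall X in Q, flux t X == 0]].

Definition update t e (c : M) : {ffun E -> M} :=
  [ffun f => if f == e then c else t f].

Lemma coboundary_uncrossed X e : ~~ crosses X e -> coboundary X e = 0.
Proof. by rewrite /crosses /coboundary; do 2!case: (_ \in _). Qed.

Lemma coboundary_crossed X e :
  crosses X e -> coboundary X e = if (e, true) \in X then 1 else -1.
Proof. by rewrite /crosses /coboundary; do 2!case: (_ \in _). Qed.

Lemma flux_modular t X Y :
  flux t X + flux t Y = flux t (X :&: Y) + flux t (X :|: Y).
Proof.
rewrite /flux -!big_split; apply: eq_bigr => e _ /=.
rewrite -!mulrzDr /coboundary !inE; congr (_ *~ _).
by do 4!case: (_ \in _).
Qed.

Lemma fluxC t X : flux t (~: X) = - flux t X.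
Proof.
rewrite /flux -sumrN; apply: eq_bigr => e _; rewrite -mulrNz /coboundary !inE.
by congr (_ *~ _); do 2!case: (_ \in _).
Qed.

Lemma flux_update t e c X :
  flux (update t e c) X = flux t X + (c - t e) *~ coboundary X e.
Proof.
rewrite /flux (bigD1 e) //= [X in _ = X + _](bigD1 e) //= ffunE eqxx.
rewrite [X in _ + X](eq_bigr (fun f => t f *~ coboundary X f)); last first.
  by move=> f /negPf fe; rewrite ffunE fe.
by rewrite mulrzBl addrAC addrCA subrr addr0.
Qed.

Lemma fsupp_update t e c :
  fsupp (update t e c) = if c == 0 then fsupp t :\ e else e |: fsupp t.
Proof.
apply/setP=> f; rewrite fun_if 2![in RHS]fun_if /= !inE ffunE.
by have [->|fe] := eqVneq f e; case: (eqVneq c 0).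
Qed.

Lemma flowsP Q S t :
  reflect (fsupp t = S /\ {in Q, forall X, flux t X = 0}) (t \in flows Q S).
Proof.
rewrite inE; apply: (iffP andP) => -[]; first move/eqP=> -> /forall_inP QX.
  by split=> // X XQ; apply/eqP/QX.
by move=> -> QX; split=> //; apply/forall_inP => X XQ; rewrite QX.
Qed.

Lemma update_idem t e c c' : update (update t e c) e c' = update t e c'.
Proof. by apply/ffunP=> f; rewrite !ffunE; case: eqP. Qed.

Lemma update_id t e : update t e (t e) = t.
Proof. by apply/ffunP=> f; rewrite !ffunE; case: eqP => // ->. Qed.

Lemma fsupp_eq0 t e : (t e == 0) = (e \notin fsupp t).
Proof. by rewrite inE negbK. Qed.

Lemma card_flows0 Q : #|flows Q set0| = 1%N.
Proof.
rewrite -(cards1 (0 : {ffun E -> M})); apply: eq_card => t; rewrite [RHS]inE.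
apply/flowsP/eqP => [[t0 _]|->].
  by apply/ffunP=> f; rewrite ffunE; apply/eqP; rewrite fsupp_eq0 t0 inE.
split=> [|X _]; first by apply/setP=> f; rewrite !inE ffunE eqxx.
by rewrite /flux big1 // => f _; rewrite ffunE mul0rz.
Qed.

(** Resetting the value at [e] to 0 is a bijection from the flows with support [e |: S] or [S] to
    the flows of the contraction. Conservation at a set separating the ends of [e] recovers the lost
    value, which is nonzero in the first case and zero in the second. *)
Lemma card_flows_uncrossed Q S e X : set_field Q -> X \in Q -> crosses X e ->
  e \notin S ->
  (#|flows (uncrossed Q [set e]) S| = #|flows Q (e |: S)| + #|flows Q S|)%N.
Proof.
move=> fQ XQ Xe eS; have [QU QC] := fQ; have QI := set_fieldI fQ.
have [X1 X1Q [/andP[X1t X1f] _]] := crossing_set true fQ XQ Xe.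
have cobX1 : coboundary X1 e = 1.
  by rewrite /coboundary X1t (negPf X1f).
have disj : [disjoint flows Q (e |: S) & flows Q S].
  rewrite -setI_eq0; apply/eqP/setP=> t; rewrite inE [RHS]inE.
  apply/andP=> -[/flowsP[t1 _] /flowsP[t2 _]].
  by move: eS; rewrite -t2 t1 setU11.
move: (cardsUI (flows Q (e |: S)) (flows Q S)).
rewrite (eqP (_ : _ :&: _ == set0)) ?setI_eq0 // cards0 addn0 => <-.
set U := _ :|: _.
have UP t : t \in U -> {in Q, forall Y, flux t Y = 0} /\ fsupp t :\ e = S.
  case/setUP=> /flowsP[ts tQ]; split; rewrite // ts.
    by rewrite setU1K.
  by apply/setDidPl; rewrite disjoint_sym disjoints1.
have inj : {in U &, injective (fun t => update t e 0)}.
  move=> t t' /UP[tQ _] /UP[tQ' _] eq_tt'.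
  have := flux_update t e 0 X1; rewrite eq_tt' flux_update tQ // tQ' //.
  rewrite cobX1 !mulr1z !add0r => /oppr_inj te.
  by rewrite -(update_id t e) -(update_id t' e) -(update_idem t e 0) eq_tt'
             update_idem te.
rewrite -(card_in_imset inj); apply: eq_card => t.
apply/flowsP/imsetP => [[tS tQ] | [t' /UP[tQ' ts'] ->]]; last first.
  split; first by rewrite fsupp_update eqxx.
  move=> Y /uncrossedP[YQ Ye]; rewrite flux_update tQ' // coboundary_uncrossed //.
    by rewrite mulr0z addr0.
  by apply: Ye; rewrite inE.
have te : t e = 0 by apply/eqP; rewrite fsupp_eq0 tS.
(* [Y] and [Z] lie on opposite sides of [e], so their intersection and union are not crossed by [e]
   and have zero flux. *)
have flux0 Y Z : Y \in Q -> Z \in Q ->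
    ((e, true) \in Y) && ((e, false) \notin Y) ->
    ((e, false) \in Z) && ((e, true) \notin Z) -> flux t Y + flux t Z = 0.
  move=> YQ ZQ Ye Ze; rewrite flux_modular !tQ ?addr0 //; apply/uncrossedP;
    (split; first by [exact: QI | exact: QU]) => f /set1P->;
    by move: Ye Ze; rewrite /crosses !inE; do 4!case: (_ \in _).
(* Conservation at [X1], where [e] has coefficient 1, forces this value. *)
pose c := - flux t X1; exists (update t e c); last first.
  by rewrite update_idem -te update_id.
have fc : {in Q, forall Y, flux (update t e c) Y = 0}.
  move=> Y YQ; rewrite flux_update te subr0.
  have [Ye | Ye] := boolP (crosses Y e); last first.
    rewrite coboundary_uncrossed // mulr0z addr0 tQ //.
    by apply/uncrossedP; split=> // f /set1P->.
  have [Yt | Yt] := boolP ((e, true) \in Y).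
    have Yf : (e, false) \notin Y by move: Ye; rewrite /crosses Yt.
    rewrite /coboundary Yt (negPf Yf) mulr1z /c -fluxC.
    by apply: flux0; rewrite ?QC ?Yt ?inE ?X1t ?X1f.
  have Yf : (e, false) \in Y by move: Ye; rewrite /crosses (negPf Yt).
  rewrite /coboundary Yf (negPf Yt) sub0r mulrNz mulr1z /c opprK addrC.
  by apply: flux0; rewrite ?X1t ?X1f ?Yf ?Yt.
have [c0 | c0] := eqVneq c 0.
  apply/setUP; right; apply/flowsP; split=> //.
  by rewrite c0 -te update_id.
apply/setUP; left; apply/flowsP; split=> //.
by rewrite fsupp_update (negPf c0) tS.
Qed.

(** A loop is absent from every conservation law, so its value can be any nonzero element. *)
Lemma card_flows_loop Q S e : {in Q, forall X, ~~ crosses X e} ->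
  e \notin S -> (#|flows Q (e |: S)| = #|M|.-1 * #|flows Q S|)%N.
Proof.
move=> Qe eS; pose g (p : M * {ffun E -> M}) := update p.2 e p.1.
have inj : {in setX [set~ 0] (flows Q S) &, injective g}.
  case=> c t [c' t']; rewrite !inE /= => /andP[_ /andP[/eqP tS _]].
  case/andP=> _ /andP[/eqP tS' _] eq_g.
  have te : t e = 0 by apply/eqP; rewrite fsupp_eq0 tS.
  have te' : t' e = 0 by apply/eqP; rewrite fsupp_eq0 tS'.
  congr (_, _); first by move/ffunP/(_ e): eq_g; rewrite !ffunE eqxx.
  by rewrite -(update_id t e) -(update_id t' e) te te' -(update_idem t e c)
             -(update_idem t' e c') -[update t e c]/(g (c, t)) eq_g.
rewrite -(cardsC1 (0 : M)) -cardsX -(card_in_imset inj); apply: eq_card => t.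
have fluxU t' c Y : Y \in Q -> flux (update t' e c) Y = flux t' Y.
  by move=> YQ; rewrite flux_update coboundary_uncrossed ?Qe // mulr0z addr0.
apply/flowsP/imsetP => [[tS tQ] | [[c t']]].
  have te : t e != 0 by rewrite fsupp_eq0 tS setU11.
  exists (t e, update t e 0); last by rewrite /g /= update_idem update_id.
  rewrite inE /= !inE te /= fsupp_update eqxx tS setU1K // eqxx /=.
  by apply/forall_inP => Y YQ; rewrite fluxU // tQ.
rewrite inE /= inE inE => /andP[c0 /flowsP[tS tQ]] ->.
split; first by rewrite fsupp_update (negPf c0) tS.
by move=> Y YQ; rewrite fluxU // tQ.
Qed.

End Flows.

(** * Totally cyclic orientations *)

(* A set o of edges stands for the orientation directing e along the dart
   (e, e \in o).  Then [directed L o X] says that every edge of L crossing X is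
   directed along its dart in X. *)
Definition directed L o X :=
  [forall e in L, ((e, e \notin o) \in X) ==> ((e, e \in o) \in X)].

Definition totally_cyclic L Q o :=
  [forall X in Q, directed L o X ==> [forall e in L, ~~ crosses X e]].

Definition num_totally_cyclic L Q :=
  (\sum_(o in powerset L) totally_cyclic L Q o)%N.

Lemma totally_cyclicP L Q o :
  reflect {in Q, forall X, directed L o X -> {in L, forall e, ~~ crosses X e}}
          (totally_cyclic L Q o).
Proof.
apply: (iffP forall_inP) => tc X XQ; have := tc X XQ.
  by move=> /implyP dX /dX /forall_inP.
by move=> dX; apply/implyP => /dX /forall_inP.
Qed.

Lemma crossesE X e o :
  crosses X e = ((e, e \notin o) \in X) (+) ((e, e \in o) \in X).
Proof. by rewrite /crosses; case: (e \in o) => //=; rewrite addbC. Qed.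

Lemma directedU1 L o X e : e \notin L -> e \notin o ->
  (directed (e |: L) o X
     = (((e, true) \in X) ==> ((e, false) \in X)) && directed L o X)
  * (directed (e |: L) (e |: o) X
     = (((e, false) \in X) ==> ((e, true) \in X)) && directed L o X).
Proof.
move=> eL eo; split; apply/forall_inP/andP.
- move=> dX; split; first by have := dX e (setU11 _ _); rewrite eo (negPf eo).
  by apply/forall_inP => f fL; apply: dX; rewrite inE fL orbT.
- case=> de /forall_inP dX f /setU1P[->|/dX //].
  by rewrite eo (negPf eo).
- move=> dX; split; first by have := dX e (setU11 _ _); rewrite setU11.
  apply/forall_inP => f fL; have := dX f; rewrite !inE fL orbT => /(_ isT).
  by have [fe|//] := eqVneq f e; rewrite fe (negPf eL) in fL.
case=> de /forall_inP dX f /setU1P[->|fL].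
  by rewrite setU11.
have := dX f fL; rewrite !inE.
by have [fe|//] := eqVneq f e; rewrite fe (negPf eL) in fL.
Qed.

(* The two extensions of o to e are both totally cyclic iff o is so after
   deleting e, and at least one is iff o is so after contracting e: if X and Y
   witness the failure of the two extensions, then X :&: Y and X :|: Y are not
   crossed by e, which forces e to be a bridge. *)
Lemma num_totally_cyclic_rec L Q e : set_field Q -> e \notin L ->
  {in uncrossed Q L, forall X, ~~ crosses X e} ->
  num_totally_cyclic (e |: L) Q
  = (num_totally_cyclic L (uncrossed Q [set e]) + num_totally_cyclic L Q)%N.
Proof.
move=> fQ eL nbr; have [QU QC] := fQ; have QI := set_fieldI fQ.
rewrite /num_totally_cyclic sum_subsets_setU1 // -big_split.
apply: eq_bigr => o; rewrite powersetE => oL.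
have eo : e \notin o by apply: contra eL => /(subsetP oL).
have Ue X : X \in uncrossed Q [set e] = (X \in Q) && ~~ crosses X e.
  apply/uncrossedP/andP => -[XQ Xe]; split=> //; first by apply: Xe; rewrite inE.
  by move=> f /set1P->.
have -> : totally_cyclic L Q o
    = totally_cyclic (e |: L) Q o && totally_cyclic (e |: L) Q (e |: o).
  apply/idP/andP => [/totally_cyclicP tc | [/totally_cyclicP tc0 /totally_cyclicP tc1]].
    have tcU X : X \in Q -> directed L o X -> {in e |: L, forall f, ~~ crosses X f}.
      move=> XQ dX f /setU1P[->|]; last exact: tc.
      by apply: nbr; apply/uncrossedP; split=> //; apply: tc.
    by split; apply/totally_cyclicP => X XQ; rewrite (directedU1 _ eL eo) => /andP[_]; apply: tcU.
  apply/totally_cyclicP => X XQ dX f fL.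
  have fLe : f \in e |: L by rewrite inE fL orbT.
  have [Xt | Xt] := boolP ((e, true) \in X).
    by apply: (tc1 X) => //; rewrite (directedU1 _ eL eo) dX Xt implybT.
  by apply: (tc0 X) => //; rewrite (directedU1 _ eL eo) dX (negPf Xt).
have -> : totally_cyclic L (uncrossed Q [set e]) o
    = totally_cyclic (e |: L) Q o || totally_cyclic (e |: L) Q (e |: o).
  apply/idP/idP => [/totally_cyclicP tc | tc]; last first.
    apply/totally_cyclicP => X; rewrite Ue => /andP[XQ Xe] dX f fL.
    have fLe : f \in e |: L by rewrite inE fL orbT.
    by case/orP: tc => /totally_cyclicP/(_ X XQ); apply=> //;
      rewrite (directedU1 _ eL eo) dX andbT; move: Xe; rewrite /crosses; do 2!case: (_ \in _).
  apply: contraT; rewrite negb_or => /andP[].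
  rewrite negb_forall_in => /exists_inP[X XQ].
  rewrite negb_imply (directedU1 _ eL eo) => /andP[/andP[Xe dX] Xc].
  rewrite negb_forall_in => /exists_inP[Y YQ].
  rewrite negb_imply (directedU1 _ eL eo) => /andP[/andP[Ye dY] Yc].
  (* A cut violating either extension contains [e]: otherwise it would survive the contraction of
     [e], where [o] is totally cyclic. *)
  have ce Z : Z \in Q -> directed L o Z -> ~~ [forall f in e |: L, ~~ crosses Z f] ->
      crosses Z e.
    move=> ZQ dZ; apply: contraR => Ze; apply/forall_inP => f /setU1P[-> //|].
    by apply: (tc Z) => //; rewrite Ue ZQ.
  have{Xc} Xce := ce X XQ dX Xc; have{Yc} Yce := ce Y YQ dY Yc.
  have cI : {in L, forall f, ~~ crosses (X :&: Y) f}.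
    apply: tc; first rewrite Ue QI //=.
      by move: Xe Ye Xce Yce; rewrite /crosses !inE; do 4!case: (_ \in _).
    apply/forall_inP => f fL; move/forall_inP/(_ f fL): dX; move/forall_inP/(_ f fL): dY.
    by rewrite !inE; do 4!case: (_ \in _).
  have cU : {in L, forall f, ~~ crosses (X :|: Y) f}.
    apply: tc; first rewrite Ue QU //=.
      by move: Xe Ye Xce Yce; rewrite /crosses !inE; do 4!case: (_ \in _).
    apply/forall_inP => f fL; move/forall_inP/(_ f fL): dX; move/forall_inP/(_ f fL): dY.
    by rewrite !inE; do 4!case: (_ \in _).
  (* No edge of [L] crosses [X]: by [cI] and [cU] the two darts of [f] lie in equally many of [X]
     and [Y], while directedness gives an inequality for each of these sets. So [e], which crosses
     [X], would be a bridge. *)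
  rewrite -(negbTE (nbr X _)) //; apply/uncrossedP; split=> // f fL.
  move: (cI f fL) (cU f fL).
  move/forall_inP/(_ f fL): dX; move/forall_inP/(_ f fL): dY.
  rewrite !(crossesE _ _ o) !inE.
  case: ((f, f \notin o) \in X); case: ((f, f \notin o) \in Y);
  by case: ((f, f \in o) \in X); case: ((f, f \in o) \in Y).
by case: (totally_cyclic _ _ o); case: (totally_cyclic _ _ _).
Qed.

(** * Reciprocity for flows by deletion and contraction *)

(* S is the support of the flow, on whose contraction the orientation lives. *)
Definition num_pairs (M : finZmodType) L Q :=
  (\sum_(S in powerset L)
     #|flows M Q S| * num_totally_cyclic (L :\: S) (uncrossed Q S))%N.

(** For supports avoiding [e] the orientations split by [num_totally_cyclic_rec], and the deletion
    parts add up to [num_pairs M L Q]. The contraction parts are joined with the terms of the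
    supports containing [e], where [e] is contracted anyway. *)
Lemma num_pairsU1 (M : finZmodType) L Q e : set_field Q -> e \notin L ->
  {in uncrossed Q L, forall X, ~~ crosses X e} ->
  num_pairs M (e |: L) Q
  = (\sum_(S in powerset L)
      (#|flows M Q S| + #|flows M Q (e |: S)|)
        * num_totally_cyclic (L :\: S) (uncrossed (uncrossed Q [set e]) S)
     + num_pairs M L Q)%N.
Proof.
move=> fQ eL nbr; rewrite /num_pairs sum_subsets_setU1 // -big_split.
apply: eq_bigr => S; rewrite powersetE => sSL.
have eS : e \notin S by apply: contra eL => /(subsetP sSL).
have -> : (e |: L) :\: S = e |: (L :\: S).
  apply/setP=> f; rewrite !inE; have [->|//] := eqVneq f e.
  by rewrite eS.
have -> : (e |: L) :\: (e |: S) = L :\: S.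
  apply/setP=> f; rewrite !inE; have [->|//] := eqVneq f e.
  by rewrite /= (negPf eL) andbF.
rewrite num_totally_cyclic_rec.
- by rewrite !uncrossedU [S :|: _]setUC /=; ring.
- exact: uncrossed_set_field.
- by rewrite inE (negPf eL) andbF.
move=> X; rewrite uncrossedU (_ : S :|: _ = L) //; first exact: nbr.
by apply/setP=> f; rewrite !inE; have [/(subsetP sSL)->|] := boolP (f \in S).
Qed.

(* The graph has a vertices and b components, so #|L| + a + b has the parity of
   its cyclomatic number. *)
Theorem flow_reciprocity L Q : set_field Q -> exists p : {poly rat},
  forall M : finZmodType, p.[#|M|%:R] = #|flows M Q L|%:R
    /\ forall a b, #|Q| = (2 ^ a)%N -> #|uncrossed Q L| = (2 ^ b)%N ->
       (-1) ^+ (#|L| + a + b) * p.[- #|M|%:R] = (num_pairs M L Q)%:R.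
Proof.
elim: {L}#|L| {-2}L (erefl #|L|) Q => [|n IHn] L Ln Q fQ.
  have L0 : L = set0 by apply: cards0_eq.
  exists 1 => M; rewrite !hornerC L0.
  rewrite card_flows0; split=> // a b; rewrite uncrossed0 => -> /eqP.
  (* Without edges [a = b], so the exponent is even. *)
  rewrite eqn_exp2l // => /eqP <-; rewrite cards0 add0n addnn -mul2n exprM sqrrN.
  rewrite !expr1n mulr1 /num_pairs powerset0 big_set1.
  rewrite card_flows0 mul1n set0D /num_totally_cyclic powerset0 big_set1.
  suff -> : totally_cyclic set0 (uncrossed Q set0) set0 by [].
  by apply/totally_cyclicP => X _ _ f; rewrite inE.
have [e eL] : exists e, e \in L by apply/set0Pn; rewrite -card_gt0 Ln.
have [L' eL' defL] : exists2 L' : {set E}, e \notin L' & L = e |: L'.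
  by exists (L :\ e); rewrite ?setD1K // !inE eqxx.
have L'n : #|L'| = n by move: Ln; rewrite defL cardsU1 eL' => -[].
(* If e is a bridge there are no nowhere-zero flows and no pairs. *)
have [/exists_inP[X /uncrossedP[XQ XL'] Xe] | ] :=
    boolP [exists X in uncrossed Q L', crosses X e].
  have te0 (M : finZmodType) S (t : {ffun E -> M}) :
      S \subset L -> t \in flows M Q S -> t e = 0.
    move=> sSL /flowsP[tS tQ]; have := tQ X XQ.
    (* Only [e] among the edges of [L] crosses [X], so conservation at [X] reads [t e = 0] up to
       sign. *)
    rewrite /flux (bigD1 e) //= big1 => [|f fe].
      rewrite coboundary_crossed // addr0; case: ifP => _; first by rewrite mulr1z.
      by rewrite mulrNz mulr1z => /eqP; rewrite oppr_eq0 => /eqP.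
    have [fL' | fL'] := boolP (f \in L').
      by rewrite coboundary_uncrossed ?XL' // mulr0z.
    suff /eqP-> : t f == 0 by rewrite mul0rz.
    rewrite fsupp_eq0 tS; apply: contra fL' => /(subsetP sSL).
    by rewrite defL !inE (negPf fe).
  exists 0 => M; rewrite !horner0; split.
    rewrite (_ : flows M Q L = set0) ?cards0 //.
    apply/setP=> t; rewrite [RHS]inE; apply/negP => tL.
    have /eqP := te0 M L t (subxx _) tL; case/flowsP: tL => tL _.
    by rewrite fsupp_eq0 tL eL.
  move=> a b _ _; rewrite mulr0 /num_pairs big1 // => S; rewrite powersetE => sSL.
  have [-> | [t tS]] := set_0Vmem (flows M Q S); first by rewrite cards0.
  have te := te0 M S t sSL tS.
  have eS : e \notin S by case/flowsP: tS => <- _; rewrite inE te eqxx.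
  have sSL' : S \subset L'.
    apply/subsetP=> f fS; have := subsetP sSL f fS; rewrite defL !inE.
    by case/orP=> // /eqP fe; rewrite fe (negPf eS) in fS.
  rewrite [num_totally_cyclic _ _]big1 ?muln0 // => o _.
  (* [Y] is whichever of [X] and its complement makes [e] directed; no other edge of [L :\: S]
     crosses it, so it is a directed cut. *)
  have [Y YQ [Ye Yc]] := crossing_set (e \in o) fQ XQ Xe.
  suff -> : totally_cyclic (L :\: S) (uncrossed Q S) o = false by [].
  have YU : Y \in uncrossed Q S.
    by apply/uncrossedP; split=> // f /(subsetP sSL') fL; rewrite Yc XL'.
  have dY : directed (L :\: S) o Y.
    apply/forall_inP => f; rewrite defL !inE => /andP[_ /orP[/eqP-> | fL']].
      by case/andP: Ye => ->; rewrite implybT.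
    have := XL' f fL'; rewrite -Yc (crossesE _ _ o).
    by case: ((f, f \notin o) \in Y); case: ((f, f \in o) \in Y).
  have eLS : e \in L :\: S by rewrite inE eS.
  by apply/negP => /totally_cyclicP/(_ Y YU dY e eLS); rewrite Yc Xe.
rewrite negb_exists_in => /forall_inP nbr.
have UL : uncrossed Q L = uncrossed Q L'.
  rewrite defL setUC -uncrossedU.
  by apply: uncrossed_id => X XU f /set1P->; apply: nbr.
have [p2 Hp2] := IHn L' L'n Q fQ.
have [/exists_inP[X XQ Xe] | ] := boolP [exists X in Q, crosses X e]; last first.
  rewrite negb_exists_in => /forall_inP loop.
  (* The edge [e] is a loop. At [- #|M|] the new factor is [- (#|M| + 1)], and its sign accounts for
     the additional edge: in a pair, [e] has one of [#|M| - 1] nonzero values or one of two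
     directions. *)
  exists (('X - 1%:P) * p2) => M; have [Hpos Hneg] := Hp2 M.
  have M0 : (0 < #|M|)%N by apply/card_gt0P; exists 0.
  have EM : #|M|%:R = (#|M|.-1)%:R + 1 :> rat by rewrite natr1 prednK.
  rewrite !hornerM !hornerXsubC {1}defL card_flows_loop // natrM Hpos; split.
    by rewrite EM addrK.
  move=> a b Qa; rewrite UL => Qb; rewrite defL num_pairsU1 //.
  rewrite (@uncrossed_id Q [set e]); last by move=> X XQ f /set1P->; apply: loop.
  rewrite (eq_bigr (fun S => #|M| *
     (#|flows M Q S| * num_totally_cyclic (L' :\: S) (uncrossed Q S)))%N).
    rewrite -big_distrr -/(num_pairs M L' Q) /= natrD natrM -(Hneg a b Qa Qb).
    by rewrite cardsU1 eL' add1n !addSn exprS; ring.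
  move=> S; rewrite powersetE => sSL'.
  rewrite card_flows_loop //; last by apply: contra eL' => /(subsetP sSL').
  by rewrite -mulSn prednK // mulnA.
have fQ1 := @uncrossed_set_field Q [set e] fQ.
have [p1 Hp1] := IHn L' L'n _ fQ1.
(* Here [e] is neither a bridge nor a loop. Contracting it lowers both [#|L|] and [a] by one while
   deleting it lowers only [#|L|], so the signs turn the difference into a sum. *)
exists (p1 - p2) => M; have [Hpos1 Hneg1] := Hp1 M; have [Hpos2 Hneg2] := Hp2 M.
rewrite !hornerD !hornerN; split.
  by rewrite Hpos1 Hpos2 (card_flows_uncrossed M fQ XQ Xe eL') natrD addrK defL.
(* A non-loop makes [#|Q|] even, which excludes [a = 0]. *)
move=> [|a] b; rewrite (card_uncrossed1 fQ XQ Xe).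
  by case: #|_| => // m; rewrite mulnS.
rewrite expnS => /eqP; rewrite eqn_pmul2l // => /eqP Qa Qb.
have Qb1 : #|uncrossed (uncrossed Q [set e]) L'| = (2 ^ b)%N.
  by rewrite uncrossedU -defL.
have Qb2 : #|uncrossed Q L'| = (2 ^ b)%N by rewrite -UL.
have Qa2 : #|Q| = (2 ^ a.+1)%N by rewrite (card_uncrossed1 fQ XQ Xe) Qa expnS.
rewrite mulrBr defL num_pairsU1 //.
rewrite (eq_bigr (fun S => #|flows M (uncrossed Q [set e]) S|
     * num_totally_cyclic (L' :\: S) (uncrossed (uncrossed Q [set e]) S))%N).
  rewrite natrD -/(num_pairs M L' (uncrossed Q [set e])).
  rewrite -(Hneg1 a b Qa Qb1) -(Hneg2 a.+1 b Qa2 Qb2) cardsU1 eL' add1n.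
  by rewrite !addSn !addnS !addSn !exprS; ring.
move=> S; rewrite powersetE => sSL'.
rewrite (card_flows_uncrossed M fQ XQ Xe); first by rewrite addnC.
by apply: contra eL' => /(subsetP sSL').
Qed.

End CutFields.

(** * Counting the unions of connected components *)

Section ClosedSets.
Variables (T : finType) (e : rel T).
Hypothesis sym_e : connect_sym e.

(** A closed set is a union of components and is determined by the roots it contains, which can form
    any set of roots in [A]. *)
Lemma card_closed_sets (A : {set T}) : closed e A ->
  #|[set X : {set T} | (X \subset A)
       && [forall x, forall y, e x y ==> ((x \in X) == (y \in X))]]|
  = (2 ^ n_comp e A)%N.
Proof.
move=> clA; pose RA := [set x in A | roots e x].
have -> : n_comp e A = #|RA|.
  by apply: eq_card => x; rewrite !inE andbC.
rewrite -card_powerset.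
set C := [set X : {set T} | _].
have clP X : X \in C -> (X \subset A) /\ forall x y, connect e x y -> (x \in X) = (y \in X).
  rewrite inE => /andP[sXA /forallP clX]; split=> // x y.
  apply: closed_connect => {}x {}y exy.
  by have /forallP/(_ y)/implyP/(_ exy)/eqP := clX x.
pose g (X : {set T}) := X :&: RA.
have inj : {in C &, injective g}.
  move=> X Y /clP[sXA clX] /clP[sYA clY] /setP eqXY; apply/setP=> x.
  have [xA | xA] := boolP (x \in A); last first.
    by rewrite (contraNF (subsetP sXA x) xA) (contraNF (subsetP sYA x) xA).
  have := eqXY (fingraph.root e x).
  rewrite !inE -(closed_connect clA (connect_root e x)) xA (roots_root sym_e) !andbT.
  by rewrite -(clX _ _ (connect_root e x)) -(clY _ _ (connect_root e x)).
rewrite -(card_in_imset inj); apply: eq_card => X; rewrite powersetE.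
apply/imsetP/idP => [[Y _ ->] | sXR]; first exact: subsetIr.
exists [set x in A | fingraph.root e x \in X].
  rewrite inE; apply/andP; split; first by apply/subsetP=> x; rewrite inE => /andP[].
  apply/forallP=> x; apply/forallP=> y; apply/implyP => exy.
  have /eqP rxy : fingraph.root e x == fingraph.root e y.
    by rewrite root_connect // connect1.
  by rewrite !inE (clA _ _ exy) rxy.
apply/setP=> x; rewrite !inE.
apply/idP/idP => [xX | /andP[/andP[_ rxX] /andP[_ /eqP rx]]].
  have := subsetP sXR x xX; rewrite inE => /andP[-> rx].
  by rewrite (eqP rx) xX rx.
by rewrite -rx.
Qed.

End ClosedSets.

(** * Unions of cycles of a permutation *)

Section Invariants.
Variable T : finType.
Implicit Types (s : {perm T}) (X Y : {set T}).

Definition invariants s : {set {set T}} :=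
  [set X : {set T} | [forall x, (s x \in X) == (x \in X)]].

Lemma invariantsP s X :
  reflect (forall x, (s x \in X) = (x \in X)) (X \in invariants s).
Proof. by rewrite inE; apply: (iffP forallP) => sX x; apply/eqP. Qed.

Lemma invariants_porbit s X x y :
  X \in invariants s -> y \in porbit s x -> (y \in X) = (x \in X).
Proof.
move=> /invariantsP sX /porbitP[i ->]; rewrite permX.
by elim: i => //= i <-; apply: sX.
Qed.

Lemma porbit_fconnect s x y :
  (y \in porbit s x) = fconnect s x y.
Proof.
apply/porbitP/idP => [[i ->] | /iter_findex <-]; first by rewrite permX fconnect_iter.
by exists (findex s x y); rewrite permX.
Qed.

(** Multiplying by the transposition lowers the number of cycles by one. If [x] and [y] were still
    in different cycles, multiplying once more would lower it again, yet this restores [s]. *)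
Lemma porbit_tperm_mul s x y : porbit s x != porbit s y ->
  porbit (tperm x y * s) x = porbit (tperm x y * s) y.
Proof.
rewrite !eq_porbit_mem => nxy; apply/eqP; rewrite eq_porbit_mem; apply: contraT => nxy'.
have xy : x != y by apply: contra nxy => /eqP->; rewrite porbit_id.
have := porbits_mul_tperm s x y; have := porbits_mul_tperm (tperm x y * s)%g x y.
rewrite /= mulgA tperm2 mul1g nxy nxy' xy.
lia.
Qed.

End Invariants.

(** * Taking darts out of their cycles *)

Section Skip.
Variable E : finType.
Implicit Types (s r : {perm dart E}) (d : dart E) (e : E) (X : {set dart E}).

Lemma skipV s d : (skip s d)^-1%g = skip s^-1 d.
Proof.
rewrite /skip invMg tpermV; apply: (mulIg s).
by rewrite mulgKV -mulgA -conjgE tpermJ permKV tpermC.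
Qed.

Lemma skip_edgeV s e : (skip_edge s e)^-1%g = skip_edge s^-1 e.
Proof. by rewrite /skip_edge !skipV. Qed.

Lemma skip_mul r s d : r d = d -> skip (r * s) d = (r * skip s d)%g.
Proof. by move=> rd; rewrite /skip permM rd mulgA. Qed.

Lemma skip_edge_mul r s e : (forall b, r (e, b) = (e, b)) ->
  skip_edge (r * s) e = (r * skip_edge s e)%g.
Proof. by move=> re; rewrite /skip_edge (skip_mul _ (re true)) (skip_mul _ (re false)). Qed.

Lemma skip_edge_self s e b : skip_edge s e (e, b) = (e, b).
Proof. by case: b; rewrite /skip_edge ?skip_self // skip_fix ?skip_self. Qed.

Lemma skipE s d x :
  skip s d x = if s x == d then s d else if x == d then d else s x.
Proof.
rewrite permM; have [->|nd] := eqVneq (s x) d; first by rewrite tpermL.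
have [->|xd] := eqVneq x d; first by rewrite tpermR.
by rewrite tpermD ?(inj_eq perm_inj) // eq_sym.
Qed.

Lemma invariants_skip s d X : X \in invariants s -> X \in invariants (skip s d).
Proof.
move=> /invariantsP sX; apply/invariantsP => x; rewrite skipE.
have [sx|_] := eqVneq (s x) d; first by rewrite sX -sx sX.
by case: eqVneq => // ->.
Qed.

Lemma skip_invariants_extend s d X : X \in invariants (skip s d) ->
  exists2 Y, Y \in invariants s & forall x, x != d -> (x \in Y) = (x \in X).
Proof.
move=> /invariantsP sX.
(* The dart [d] has to be put on the side of its successor under [s]. *)
exists [set x | if x == d then s d \in X else x \in X]; last first.
  by move=> x /negPf xd; rewrite inE xd.
apply/invariantsP => x; rewrite !inE; have := sX x; rewrite skipE.
have [->|xd] := eqVneq x d; first by case: ifP.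
by case: ifP.
Qed.

Lemma invariants_skip_edge s e X :
  X \in invariants s -> X \in invariants (skip_edge s e).
Proof. by move=> sX; do 2!apply: invariants_skip. Qed.

Lemma skip_edge_invariants_extend s e X : X \in invariants (skip_edge s e) ->
  exists2 Y, Y \in invariants s & forall x, x.1 != e -> (x \in Y) = (x \in X).
Proof.
move=> /skip_invariants_extend[Y /skip_invariants_extend[Z Zs ZY] YX].
by exists Z => // x xe; rewrite ZY ?YX //; apply: contra xe => /eqP->.
Qed.

End Skip.

(** * Faces under deletion and contraction *)

Section Minors.
Variable E : finType.
Implicit Types (G H : ribbon_graph E) (e : E) (X Y : {set dart E}) (s : {perm dart E}).

Definition edge_tperm e : {perm dart E} := tperm (e, true) (e, false).

Lemma edge_tpermE e b : edge_tperm e (e, b) = (e, ~~ b).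
Proof. by case: b; rewrite ?tpermL ?tpermR. Qed.

Lemma mem_edge_tperm e X x :
  ~~ crosses X e -> (edge_tperm e x \in X) = (x \in X).
Proof.
by rewrite /crosses => Xe; case: tpermP => // ->; move: Xe; do 2!case: (_ \in _).
Qed.

(** Since [s] fixes the darts of [e], the product exchanges them, and this 2-cycle imposes the only
    new condition. *)
Lemma invariants_edge_tperm e s X : (forall b, s (e, b) = (e, b)) ->
  (X \in invariants (edge_tperm e * s)) = (X \in invariants s) && ~~ crosses X e.
Proof.
move=> se; apply/invariantsP/andP => [tX | [/invariantsP sX Xe] x]; last first.
  by rewrite permM sX mem_edge_tperm.
have Xe : ~~ crosses X e.
  by rewrite /crosses -(tX (e, true)) permM edge_tpermE se addbb.
split=> //; apply/invariantsP => x.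
by move: (tX (edge_tperm e x)); rewrite permM tpermK mem_edge_tperm.
Qed.

(** On the darts of [e], [edge_tperm e] undoes [opp_perm E]; the product fixes them and can be moved
    across [skip_edge]. In the face permutation of a minor the removed darts thus form a separate
    2-cycle. *)
Lemma opp_mul_skip_edge e s : (opp_perm E * skip_edge s e
  = edge_tperm e * skip_edge (edge_tperm e * (opp_perm E * s)) e)%g.
Proof.
rewrite [(_ * (opp_perm E * s))%g]mulgA skip_edge_mul; first by rewrite !mulgA tperm2 mul1g.
by move=> b; rewrite permM edge_tpermE permE; case: b.
Qed.

Lemma face_perm_delete G e : face_perm (delete G e)
  = (edge_tperm e * skip_edge (edge_tperm e * face_perm G) e)%g.
Proof. by rewrite /face_perm /= skip_edgeV opp_mul_skip_edge. Qed.

Lemma face_perm_contract G e : face_perm (contract G e)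
  = (edge_tperm e * skip_edge (edge_tperm e * face_perm G * edge_tperm e) e)%g.
Proof.
by rewrite /face_perm /= skip_edgeV opp_mul_skip_edge /contract_node invMg tpermV !mulgA.
Qed.

Lemma left_face_eq G (d d' : dart E) : (left_face G d == left_face G d')
  = (porbit (face_perm G) d == porbit (face_perm G) d').
Proof. by rewrite /left_face; apply: inj_eq => A B []. Qed.

Definition delete_or_contract G e :=
  if coloop G e then contract G e else delete G e.

Lemma invariants_delete_or_contract G e X :
  X \in invariants (face_perm G) -> ~~ crosses X e ->
  X \in invariants (face_perm (delete_or_contract G e)).
Proof.
rewrite /delete_or_contract; case: ifP => _;
rewrite ?face_perm_contract ?face_perm_delete;
move: (face_perm G) => F /invariantsP FX Xe;
rewrite (invariants_edge_tperm _ (skip_edge_self _ _)) Xe andbT;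
by apply/invariants_skip_edge/invariantsP => x; rewrite !permM ?mem_edge_tperm // FX mem_edge_tperm.
Qed.

(* The permutation under [skip_edge] in [face_perm_delete] or
   [face_perm_contract] has both darts of e in one cycle: for a coloop it is
   conjugate to [face_perm G] by the swap of these darts, and for a non-coloop
   composing with the swap joins the two faces at e. *)
Lemma delete_or_contract_invariants_extend G e X :
  X \in invariants (face_perm (delete_or_contract G e)) ->
  exists Y, [/\ Y \in invariants (face_perm G), ~~ crosses Y e
    & forall x, x.1 != e -> (x \in Y) = (x \in X)].
Proof.
rewrite /delete_or_contract /coloop left_face_eq; case: ifP;
rewrite ?face_perm_contract ?face_perm_delete;
move: (face_perm G) => F; [move/eqP=> coe | move/negbT=> ncoe];
rewrite (invariants_edge_tperm _ (skip_edge_self _ _)) => /andP[];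
move=> /skip_edge_invariants_extend[Y YF YX] _; exists Y.
  pose W := edge_tperm e @^-1: Y.
  have WF : W \in invariants F.
    apply/invariantsP => x; rewrite !inE.
    move/invariantsP/(_ (edge_tperm e x)): YF; rewrite !permM.
    by rewrite tpermK.
  have Ye : ~~ crosses Y e.
    have : (e, true) \in porbit F (e, false) by rewrite -coe porbit_id.
    move/(invariants_porbit WF); rewrite !inE !edge_tpermE /= /crosses => ->.
    by rewrite addbb.
  split=> //; apply/invariantsP => x; move/invariantsP/(_ (edge_tperm e x)): YF.
  by rewrite !permM tpermK !mem_edge_tperm.
have Ye : ~~ crosses Y e.
  have : (e, true) \in porbit (edge_tperm e * F) (e, false).
    by rewrite -(porbit_tperm_mul ncoe) porbit_id.
  by move/(invariants_porbit YF); rewrite /crosses => ->; rewrite addbb.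
split=> //; apply/invariantsP => x; move/invariantsP/(_ (edge_tperm e x)): YF.
by rewrite !permM tpermK !mem_edge_tperm.
Qed.

Lemma delete_contract_cons G e (s : seq E) :
  delete_contract G (e :: s) = delete_contract (delete_or_contract G e) s.
Proof. by []. Qed.

Lemma rg_edges_delete_or_contract G e :
  rg_edges (delete_or_contract G e) = rg_edges G :\ e.
Proof. by rewrite /delete_or_contract; case: ifP. Qed.

Lemma rg_edges_delete_contract G (s : seq E) :
  rg_edges (delete_contract G s) = rg_edges G :\: [set e in s].
Proof.
elim: s G => [|e s IHs] G; first by apply/setP=> f; rewrite !inE.
rewrite delete_contract_cons IHs rg_edges_delete_or_contract.
by apply/setP=> f; rewrite !inE negb_or andbCA andbA.
Qed.

Lemma invariants_delete_contract G (s : seq E) X :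
  X \in uncrossed (invariants (face_perm G)) [set e in s] ->
  X \in invariants (face_perm (delete_contract G s)).
Proof.
elim: s G => [|e s IHs] G; first by case/uncrossedP.
move=> /uncrossedP[XG Xs]; rewrite delete_contract_cons; apply: IHs.
apply/uncrossedP; split=> [|f]; last by rewrite inE => fs; apply: Xs; rewrite !inE fs orbT.
by apply: invariants_delete_or_contract => //; apply: Xs; rewrite !inE eqxx.
Qed.

Lemma delete_contract_invariants_extend G (s : seq E) X :
  X \in invariants (face_perm (delete_contract G s)) ->
  exists2 Y, Y \in uncrossed (invariants (face_perm G)) [set e in s]
    & forall x, x.1 \notin s -> (x \in Y) = (x \in X).
Proof.
elim: s G => [|e s IHs] G.
  by move=> XG; exists X => //; apply/uncrossedP; split=> // f; rewrite inE.
rewrite delete_contract_cons => /IHs[Y /uncrossedP[YH Ys] YX].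
have [Z [ZG Ze ZY]] := delete_or_contract_invariants_extend YH.
exists Z => [|x]; last by rewrite inE negb_or => /andP[xe xs]; rewrite ZY ?YX.
apply/uncrossedP; split=> // f; rewrite !inE.
have [->|fe /= fs] := eqVneq f e => //.
by rewrite /crosses !ZY //; apply: Ys; rewrite inE.
Qed.

(** The two fields may differ on the darts of removed edges, but directedness and crossing only
    concern the edges that remain. The right-hand side depends on the set of elements of [s], not on
    their order. *)
Lemma totally_cyclic_delete_contract G (s : seq E) (o : {set E}) :
  let H := delete_contract G s in
  totally_cyclic (rg_edges H) (invariants (face_perm H)) o
  = totally_cyclic (rg_edges G :\: [set e in s])
      (uncrossed (invariants (face_perm G)) [set e in s]) o.
Proof.
rewrite /= rg_edges_delete_contract; apply/totally_cyclicP/totally_cyclicP => tc X XH dX f fL.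
  by apply: (tc X) => //; apply: invariants_delete_contract.
have [Y YG YX] := delete_contract_invariants_extend XH.
have agree g b : g \in rg_edges G :\: [set e in s] -> ((g, b) \in Y) = ((g, b) \in X).
  by rewrite !inE => /andP[gs _]; apply: YX.
rewrite /crosses -!agree // -/(crosses Y f); apply: tc => //.
apply/forall_inP => g gL; rewrite !agree //.
exact: (forall_inP dX).
Qed.

Lemma invariants_set_field s : set_field (invariants s).
Proof.
split=> [X Y /invariantsP sX /invariantsP sY | X /invariantsP sX];
by apply/invariantsP => x; rewrite !inE ?sX ?sY.
Qed.

End Minors.

(** * Boundaries of sets of faces as cuts *)

Section FaceCuts.
Variables (E : finType) (G : ribbon_graph E).
Local Notation face := ({set dart E} + 'I_(rg_isolated G))%type.
Implicit Types (X : {set dart E}) (K : {set face}) (o sigma : orientation G).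

Local Notation L := (rg_edges G).
Local Notation Q := (invariants (face_perm G)).

Definition left_darts K : {set dart E} := [set d | left_face G d \in K].

Lemma left_darts_invariant K : left_darts K \in Q.
Proof.
apply/invariantsP => x; rewrite !inE /left_face.
by have := porbit_perm (face_perm G) 1 x; rewrite expg1 => ->.
Qed.

Lemma boundaryE K (e : edge G) : (e \in boundary K) = crosses (left_darts K) (val e).
Proof.
rewrite /crosses !inE /coloop.
by case: eqP => //= ->; rewrite addbb.
Qed.

Lemma face_permE d : face_perm G d = (rg_node G)^-1%g (Defs.opp d).
Proof. by rewrite permM [opp_perm E d]permE. Qed.

Lemma face_perm_dart d : ((face_perm G d).1 \in L) = (d.1 \in L).
Proof.
have nodeV x : (((rg_node G)^-1%g x).1 \in L) = (x.1 \in L).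
  have := perm_closed x (perm_onV (rg_node_on G)).
  by rewrite !inE.
by rewrite face_permE nodeV.
Qed.

(** A member of [Q] may contain darts of edges outside [G], which belong to no face; hence agreement
    is claimed on the darts of [G]. *)
Lemma invariants_faces X : X \in Q ->
  exists2 K : {set face}, K \subset faces G &
    forall d, d.1 \in L -> (d \in left_darts K) = (d \in X).
Proof.
move=> XQ; exists [set left_face G d | d in [set d in X | d.1 \in L]].
  apply/subsetP=> f /imsetP[d]; rewrite inE => /andP[_ dL] ->.
  by rewrite inE imset_f // inE.
move=> d dL; rewrite inE; apply/imsetP/idP => [[d'] | dX]; last first.
  by exists d; rewrite ?inE ?dX.
rewrite inE => /andP[d'X _] [dd'].
by rewrite (@invariants_porbit _ _ _ d' d XQ) // -dd' porbit_id.
Qed.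

Definition positive_edges o : {set E} := [set val e | e : edge G & o e].

Lemma mem_positive_edges o e : (val e \in positive_edges o) = o e.
Proof.
apply/imsetP/idP => [[e']|oe]; last by exists e; rewrite ?inE.
by rewrite inE => oe' /val_inj->.
Qed.

Lemma card_orientations (P : pred {set E}) :
  #|[set o : orientation G | P (positive_edges o)]|
  = (\sum_(A in powerset L) P A)%N.
Proof.
have inj : injective positive_edges.
  move=> o o' eq_o; apply/ffunP=> e.
  by rewrite -!mem_positive_edges eq_o.
rewrite -(card_imset _ inj) -sum1_card (bigID P) /= [X in (_ + X)%N]big1 ?addn0; last first.
  by move=> A /andP[/imsetP[o]]; rewrite inE => Po -> /negP.
rewrite [RHS](bigID P) /= [X in (_ + X)%N]big1 ?addn0; last first.
  by move=> A /andP[_ /negPf->].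
rewrite [RHS](eq_bigr (fun _ => 1%N)); last by move=> A /andP[_ ->].
apply: eq_bigl => A; case PA: (P A); rewrite ?andbF // !andbT powersetE.
apply/imsetP/idP => [[o _ ->] | sAL].
  by apply/subsetP=> _ /imsetP[e _ ->]; apply: valP.
suff defA : A = positive_edges [ffun e => val e \in A].
  by exists [ffun e => val e \in A]; rewrite // inE -defA.
apply/setP=> e; apply/idP/imsetP => [eA | [e']].
  by exists (exist _ e (subsetP sAL e eA)); rewrite // inE ffunE.
by rewrite inE ffunE => eA ->.
Qed.

(** A boundary with all entries 1 is the directed cut of [left_darts K], and one with all entries -1
    is that of its complement. Edges outside the boundary constrain neither side. *)
Lemma boundary_acyclicE o :
  boundary_acyclic o = totally_cyclic L Q (positive_edges o).
Proof.
pose w := positive_edges o.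
have bvE K (e : edge G) : e \in boundary K ->
    boundary_vector o K e = if (val e, val e \in w) \in left_darts K then 1 else -1.
  by move=> eb; rewrite /boundary_vector eb /= inE mem_positive_edges.
apply/forallP/totally_cyclicP => [ba X XQ dX e eL | tc K].
  have [K sK FX] := invariants_faces XQ.
  have bX (f : edge G) : (f \in boundary K) = crosses X (val f).
    by rewrite boundaryE /crosses !FX //; apply: (valP f).
  apply/negP => Xe; have /implyP := ba K; case/(_ _)/negP.
    rewrite sK; apply/set0Pn; exists (exist _ e eL).
    by rewrite bX.
  apply/orP; left; apply/forall_inP => f fb; rewrite bvE // FX; last exact: (valP f).
  move/forall_inP/(_ (val f) (valP f)): dX; move: fb; rewrite bX (crossesE _ _ w).
  by do 2!case: ((_, _) \in X).
apply/implyP => /andP[_ /set0Pn[e]]; rewrite boundaryE => eb; apply/negP.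
have [_ QC] := invariants_set_field (face_perm G).
case/orP => /forall_inP coh.
  suff dF : directed L w (left_darts K).
    by move: (tc _ (left_darts_invariant K) dF (val e) (valP e)); rewrite eb.
  apply/forall_inP => f fL; have := coh (exist _ f fL).
  rewrite boundaryE /= (crossesE _ _ w) => cf.
  apply/implyP => f1; apply: contraT => f2; have := cf.
  rewrite f1 (negPf f2) => /(_ isT); rewrite bvE /= ?(negPf f2) //.
  by rewrite boundaryE (crossesE _ _ w) /= f1 (negPf f2).
suff dF : directed L w (~: left_darts K).
  move: (tc _ (QC _ (left_darts_invariant K)) dF (val e) (valP e)).
  by rewrite crossesC eb.
apply/forall_inP => f fL; have := coh (exist _ f fL).
rewrite boundaryE /= (crossesE _ _ w) => cf; rewrite ![_ \in ~: _]inE.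
apply/implyP => f1; apply/negP => f2; have := cf.
rewrite f2 (negPf f1) => /(_ isT); rewrite bvE /= ?f2 //.
by rewrite boundaryE (crossesE _ _ w) /= f2 (negPf f1).
Qed.

(** * Local tensions as flows of the dual graph *)

Section Tensions.
Variables (M : finZmodType) (sigma : orientation G).
Implicit Types t : {ffun edge G -> M}.

(* t is turned into a flow for the orientation along the darts (e, true). *)
Definition sign_by (b : bool) (x : M) := if b then x else - x.

Lemma sign_byK b : involutive (sign_by b).
Proof. by case: b => x //=; apply: opprK. Qed.

Definition flow_of t : {ffun E -> M} :=
  [ffun e => if insub e is Some e' then sign_by (sigma e') (t e') else 0].

Lemma flow_of_val t e : flow_of t (val e) = sign_by (sigma e) (t e).
Proof. by rewrite ffunE valK. Qed.

Lemma flow_of_out t e : e \notin L -> flow_of t e = 0.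
Proof. by move=> eL; rewrite ffunE insubN. Qed.

Lemma flow_of_inj : injective flow_of.
Proof.
move=> t t' eqt; apply/ffunP=> e; apply: (inv_inj (sign_byK (sigma e))).
by rewrite -!flow_of_val eqt.
Qed.

Lemma fsupp_flow_of t : fsupp (flow_of t) = supp t.
Proof.
apply/setP=> e; rewrite inE; apply/idP/imsetP => [te | [e' te' ->]]; last first.
  rewrite flow_of_val; move: te'; rewrite inE.
  by case: (sigma e'); rewrite //= oppr_eq0.
have eL : e \in L by apply: contraNT te => eL; rewrite flow_of_out.
exists (exist _ e eL) => //; rewrite inE; apply: contra te => /eqP te.
have -> : e = val (exist _ e eL : edge G) by [].
by rewrite flow_of_val te /sign_by; case: ifP; rewrite ?oppr0.
Qed.

Lemma flow_of_surj (t' : {ffun E -> M}) : fsupp t' \subset L ->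
  exists t, flow_of t = t'.
Proof.
move=> sL; exists [ffun e => sign_by (sigma e) (t' (val e))]; apply/ffunP=> e.
have [eL | eL] := boolP (e \in L).
  have -> : e = val (exist _ e eL : edge G) by [].
  by rewrite flow_of_val ffunE sign_byK.
rewrite flow_of_out //; apply/esym/eqP; rewrite fsupp_eq0.
by apply: contra eL => /(subsetP sL).
Qed.

(** The sign of [sigma] occurs both in [flow_of t] and in [boundary_vector], and cancels. *)
Lemma boundary_sumE t (f : face) :
  \sum_(e in boundary [set f]) t e *~ boundary_vector sigma [set f] e
  = flux (flow_of t) (left_darts [set f]).
Proof.
rewrite /flux (bigID (mem L)) /= [X in _ = _ + X]big1 ?addr0; last first.
  by move=> e eL; rewrite flow_of_out ?mul0rz.
rewrite [RHS]big_sub [LHS]big_mkcond; apply: eq_bigr => e _.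
rewrite boundaryE; case: ifP => [ce | /negbT ce]; last first.
  by rewrite coboundary_uncrossed ?mulr0z.
rewrite coboundary_crossed // flow_of_val /boundary_vector boundaryE ce /=.
have -> d : (left_face G d \in [set f]) = (d \in left_darts [set f]) by rewrite [RHS]inE.
move: ce; rewrite /crosses; case: (sigma e) => //=.
case: ((sval e, true) \in _); case: ((sval e, false) \in _) => //= _;
by rewrite ?mulrNz ?mulr1z ?opprK.
Qed.

(** In this form the flux can be split along the cycles of [face_perm G]. *)
Lemma flux_darts (t' : {ffun E -> M}) X :
  flux t' X = \sum_(d in X) sign_by d.2 (t' d.1).
Proof.
rewrite [RHS]big_mkcond /=.
rewrite [RHS](eq_bigr (fun d => if (d.1, d.2) \in X then sign_by d.2 (t' d.1) else 0));
  last by case.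
rewrite -(pair_bigA _ (fun e b => if (e, b) \in X then sign_by b (t' e) else 0)) /=.
apply: eq_bigr => e _; rewrite big_bool /= /coboundary.
by do 2!case: ((e, _) \in X) => /=;
  rewrite ?subrr ?subr0 ?sub0r ?mulr0z ?mulrNz ?mulr1z ?addr0 ?add0r ?addrN.
Qed.

(** A member of [Q] is a disjoint union of cycles, so conservation at the faces adds up to
    conservation at all of [Q]. *)
Lemma local_tensionE t :
  local_tension sigma t = [forall X in Q, flux (flow_of t) X == 0].
Proof.
apply/forall_inP/forall_inP => fl X; last first.
  by move=> _; rewrite boundary_sumE fl ?left_darts_invariant.
move=> XQ; rewrite flux_darts.
rewrite (partition_big (porbit (face_perm G)) (mem [set porbit (face_perm G) d | d in X]));
  last by move=> d dX; rewrite inE imset_f.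
apply/eqP/big1 => _ /imsetP[d dX ->].
(* A cycle of darts outside [G] is not a face, but the flow vanishes on its edges. *)
have [dL | dL] := boolP (d.1 \in L); last first.
  apply: big1 => x /andP[_]; rewrite eq_porbit_mem => xd.
  have LQ : darts_of L \in Q by apply/invariantsP => y; rewrite !inE face_perm_dart.
  have := invariants_porbit LQ xd; rewrite !inE (negPf dL) => xL.
  by rewrite flow_of_out ?xL // /sign_by oppr0; case: ifP.
have ff : left_face G d \in faces G by rewrite inE imset_f // inE.
apply: etrans (eqP (fl _ ff)); rewrite boundary_sumE flux_darts.
apply: eq_bigl => x; rewrite !inE.
rewrite left_face_eq; case: eqVneq => [xd|]; rewrite ?andbF // andbT.
by rewrite (@invariants_porbit _ _ _ d x XQ) // -xd porbit_id.
Qed.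

Lemma card_tensions (S : {set E}) : S \subset L ->
  #|[set t : {ffun edge G -> M} | local_tension sigma t & supp t == S]| = #|flows M Q S|.
Proof.
move=> sSL; rewrite -(card_imset _ flow_of_inj); apply: eq_card => t'.
apply/imsetP/idP => [[t] | ].
  by rewrite !inE local_tensionE andbC => tP ->; rewrite fsupp_flow_of.
move=> /[dup] /flowsP[t'S _]; rewrite inE => t'P.
have [|t deft] := @flow_of_surj t'; first by rewrite t'S.
by exists t => //; rewrite inE local_tensionE -fsupp_flow_of andbC deft.
Qed.

End Tensions.

(** * Numbers of faces and components as exponents of 2 *)

Lemma connect_sym_face_perm : connect_sym (frel (face_perm G)).
Proof. exact/fconnect_sym/perm_inj. Qed.

Lemma connect_sym_vertex_edge : connect_sym (same_vertex_or_edge G).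
Proof.
apply: sym_connect_sym => x y; rewrite /same_vertex_or_edge /= porbit_sym; congr (_ || _).
exact: eq_sym.
Qed.

Lemma mem_invariants X : (X \in Q) =
  [forall x, forall y, frel (face_perm G) x y ==> ((x \in X) == (y \in X))].
Proof.
apply/invariantsP/forallP => [XF x | XF x].
  by apply/forallP => y; apply/implyP => /eqP <-; rewrite XF.
by apply/esym/eqP; have /forallP/(_ (face_perm G x))/implyP -> := XF x; rewrite /= ?eqxx.
Qed.

(** A set invariant under [face_perm G] and crossed by no edge is invariant under both [opp] and
    [rg_node G], hence a union of connected components. *)
Lemma mem_uncrossed_invariants X : (X \in uncrossed Q L) =
  [forall x, forall y, same_vertex_or_edge G x y ==> ((x \in X) == (y \in X))].
Proof.
have edgeX : X \in uncrossed Q L -> forall e b b', ((e, b) \in X) = ((e, b') \in X).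
  case/uncrossedP => /invariantsP XF Xe e b b'.
  suff : ~~ crosses X e by rewrite /crosses; case: b b' => -[]; do 2!case: (_ \in _).
  have [/Xe // | eL] := boolP (e \in L).
  (* [rg_node G] fixes the darts of an edge outside [G], so [face_perm G] exchanges them. *)
  have := XF (e, true); rewrite face_permE (out_perm (perm_onV (rg_node_on G))).
    by rewrite /crosses /Defs.opp /= => ->; rewrite addbb.
  by rewrite inE.
apply/idP/forallP => [XU x | XR].
  have [/invariantsP XF _] := uncrossedP _ _ _ XU.
  apply/forallP => y; apply/implyP => /orP[].
    move=> yx; apply/eqP/esym; apply: (@invariants_porbit _ (rg_node G) X) => //.
    apply/invariantsP => z; have := XF (Defs.opp (rg_node G z)).
    rewrite face_permE oppK permK => ->; case: (rg_node G z) => e b.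
    exact: edgeX.
  by case: x y => e b [e' b'] /= /eqP->; apply/eqP/edgeX.
have XR' x y : same_vertex_or_edge G x y -> (x \in X) = (y \in X).
  by move=> xy; apply/eqP; have /forallP/(_ y)/implyP := XR x; apply.
have XE x y : y.1 == x.1 -> (x \in X) = (y \in X).
  by move=> xy; apply: XR'; rewrite /same_vertex_or_edge /= xy orbT.
have XV x : ((rg_node G)^-1%g x \in X) = (x \in X).
  apply/esym/XR'; rewrite /same_vertex_or_edge /= -porbitV.
  by rewrite -{1}[(rg_node G)^-1%g]expg1 mem_porbit.
apply/uncrossedP; split=> [|e _].
  by apply/invariantsP => x; rewrite face_permE XV; apply: XE.
by rewrite /crosses (XE (e, true) (e, false)) // addbb.
Qed.

(* The two darts of an edge outside G form one cycle of [face_perm G] and one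
   class of [same_vertex_or_edge G], so these edges add the same number to both
   exponents below and leave the parity of their sum unchanged. *)
Definition removed_darts : {set dart E} := ~: darts_of L.

Lemma card_invariants :
  #|Q| = (2 ^ (#|[set left_face G d | d in darts_of L]|
               + n_comp (frel (face_perm G)) removed_darts))%N.
Proof.
have symF := connect_sym_face_perm.
have -> : Q = [set X : {set dart E} | (X \subset setT)
       && [forall x, forall y, frel (face_perm G) x y ==> ((x \in X) == (y \in X))]].
  by apply/setP=> X; rewrite mem_invariants inE subsetT.
rewrite card_closed_sets //; last by move=> x y _; rewrite !inE.
congr (2 ^ _)%N; rewrite (eq_n_comp_r (_ : _ =i predT)); last by move=> x; rewrite !inE.
rewrite (n_compC (darts_of L)); congr (_ + _)%N; last first.
  by apply: eq_n_comp_r => x; rewrite !inE.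
have clL : closed (frel (face_perm G)) (darts_of L).
  by move=> x y /eqP <-; rewrite !inE face_perm_dart.
have faceE x y : (left_face G x == left_face G y) = fconnect (face_perm G) x y.
  by rewrite -porbit_fconnect porbit_sym -eq_porbit_mem left_face_eq.
pose RL := [set d in darts_of L | froots (face_perm G) d].
have -> : n_comp (frel (face_perm G)) (darts_of L) = #|RL|.
  by apply: eq_card => x; rewrite [RHS]inE !inE andbC.
have inj : {in RL &, injective (left_face G)}.
  move=> x y; rewrite !inE => /andP[_ /eqP rx] /andP[_ /eqP ry] /eqP.
  rewrite faceE => xy; rewrite -rx -ry; apply/eqP.
  by rewrite root_connect.
rewrite -(card_in_imset inj); apply: eq_card => f; apply/imsetP/imsetP => -[d].
  by rewrite inE => /andP[dL _] ->; exists d.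
move=> dL ->; exists (froot (face_perm G) d); last first.
  by apply/eqP; rewrite faceE connect_root.
by rewrite inE roots_root // -(closed_connect clL (connect_root _ d)) dL.
Qed.

Lemma card_uncrossed_invariants :
  #|uncrossed Q L| = (2 ^ (n_comp (same_vertex_or_edge G) (darts_of L)
               + n_comp (frel (face_perm G)) removed_darts))%N.
Proof.
have symR := connect_sym_vertex_edge; have symF := connect_sym_face_perm.
have clL : closed (same_vertex_or_edge G) (darts_of L).
  move=> x y /orP[xy | /eqP xy]; last by rewrite !inE xy.
  apply/esym; apply: (@invariants_porbit _ (rg_node G)) => //.
  by apply/invariantsP => z; rewrite (perm_closed _ (rg_node_on G)).
have -> : uncrossed Q L = [set X : {set dart E} | (X \subset setT)
       && [forall x, forall y, same_vertex_or_edge G x y ==> ((x \in X) == (y \in X))]].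
  by apply/setP=> X; rewrite mem_uncrossed_invariants inE subsetT.
rewrite card_closed_sets //; last by move=> x y _; rewrite !inE.
congr (2 ^ _)%N; rewrite (eq_n_comp_r (_ : _ =i predT)); last by move=> x; rewrite !inE.
rewrite (n_compC (darts_of L)); congr (_ + _)%N.
rewrite (eq_n_comp_r (_ : [predC darts_of L] =i removed_darts)); last by move=> x; rewrite !inE.
have clV : closed (same_vertex_or_edge G) removed_darts.
  by move=> x y xy; rewrite !inE; congr (~~ _); have := clL x y xy; rewrite !inE.
have clF : closed (frel (face_perm G)) removed_darts.
  by move=> x y /eqP <-; rewrite !inE face_perm_dart.
(* No dart of an edge of [G] lies in [removed_darts], so both relations have the same closed sets
   there, and equal powers of 2 give equal numbers of components. *)
apply: (@expnI 2) => //.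
rewrite -(card_closed_sets symR clV) -(card_closed_sets symF clF).
apply: eq_card => X; rewrite [LHS]inE [RHS]inE.
case sX: (X \subset removed_darts) => //=.
rewrite -mem_uncrossed_invariants -mem_invariants.
apply/uncrossedP/idP => [[]|XQ] //; split=> // e eL.
have nX b : ((e, b) \in X) = false.
  by apply/negP => /(subsetP sX); rewrite !inE eL.
by rewrite /crosses !nX.
Qed.

End FaceCuts.

Lemma card_residue k : (0 < k)%N -> #|residue k| = k.
Proof. by move=> k0; rewrite card_ord prednK. Qed.

(** * Pairs of a tension and an orientation *)

Section Pairs.
Variables (E : finType) (G : ribbon_graph E) (sigma : orientation G).
Variables (order : {set E} -> seq E).
Hypothesis order_enum : forall A : {set E}, perm_eq (order A) (enum A).

Local Notation L := (rg_edges G).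
Local Notation Q := (invariants (face_perm G)).

Lemma card_boundary_acyclic (A : {set E}) :
  #|[set o : orientation (delete_contract G (order A)) | boundary_acyclic o]|
  = num_totally_cyclic (L :\: A) (uncrossed Q A).
Proof.
have defA : [set e in order A] = A.
  by apply/setP=> e; rewrite inE (perm_mem (order_enum A)) mem_enum.
apply: (@etrans _ _ (num_totally_cyclic (L :\: [set e in order A])
  (uncrossed Q [set e in order A]))); last by rewrite defA.
rewrite /num_totally_cyclic -rg_edges_delete_contract -card_orientations.
apply: eq_card => o; rewrite !inE boundary_acyclicE totally_cyclic_delete_contract.
by rewrite rg_edges_delete_contract.
Qed.

(** Among the pairs whose tension has a given support [S], the number of orientations is the same
    for every tension. *)
Lemma num_tension_orientation_pairsE k :
  num_tension_orientation_pairs sigma order k = num_pairs (residue k) L Q.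
Proof.
rewrite /num_tension_orientation_pairs -sum1_card.
rewrite (eq_bigl (fun p => local_tension sigma (tag p) && boundary_acyclic (tagged p)));
  last by move=> p; rewrite inE.
rewrite -(@sig_big_dep _ _ _ _ _ (local_tension sigma)
  (fun t o => boundary_acyclic o) (fun _ _ => 1%N)) /=.
rewrite (eq_bigr (fun t => num_totally_cyclic (L :\: supp t) (uncrossed Q (supp t))));
  last by move=> t _; rewrite -card_boundary_acyclic -sum1_card; apply: eq_bigl => o; rewrite inE.
rewrite (partition_big (@supp _ _ _) (fun S => S \in powerset L)); last first.
  move=> t _; rewrite /= powersetE; apply/subsetP=> _ /imsetP[e _ ->]; exact: valP.
rewrite /num_pairs; apply: eq_bigr => S; rewrite powersetE => sSL.
rewrite -(card_tensions _ sigma sSL).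
rewrite (eq_bigr (fun _ => num_totally_cyclic (L :\: S) (uncrossed Q S))); last first.
  by move=> t /andP[_ /eqP->].
by rewrite sum_nat_const; congr (_ * _)%N; apply: eq_card => t; rewrite inE.
Qed.

End Pairs.

(** * The sign and the conclusion *)

Lemma card_faces (E : finType) (G : ribbon_graph E) :
  #|faces G| = (#|[set left_face G d | d in darts_of (rg_edges G)]| + rg_isolated G)%N.
Proof.
rewrite /faces cardsU (_ : _ :&: _ = set0) ?cards0 ?subn0; last first.
  apply/setP=> f; rewrite !inE; apply/andP=> -[/imsetP[d _ ->] /imsetP[i _]].
  by [].
congr (_ + _)%N; rewrite card_imset ?card_ord //.
by move=> i j [].
Qed.

Theorem theorem4p2 (E : finType) (G : ribbon_graph E) (sigma : orientation G)
    (order : {set E} -> seq E)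
    (order_enum : forall A : {set E}, perm_eq (order A) (enum A)) :
  exists tau : {poly rat},
    local_tension_polynomial sigma tau /\
    forall k : nat, (0 < k)%N ->
      (-1) ^ (#|rg_edges G|%:Z - #|faces G|%:Z + (ncomponents G)%:Z)
        * tau.[- k%:R]
      = (num_tension_orientation_pairs sigma order k)%:R.
Proof.
have [p p_reciprocity] :=
  flow_reciprocity (rg_edges G) (invariants_set_field (face_perm G)).
exists p; split=> k k0; have [p_pos p_neg] := p_reciprocity (residue k);
  rewrite card_residue // in p_pos p_neg.
  by rewrite p_pos /num_nowhere_zero_tensions (card_tensions _ sigma (subxx _)).
rewrite num_tension_orientation_pairsE // -(p_neg _ _ (card_invariants G)
  (card_uncrossed_invariants G)) card_faces /ncomponents.
set l := #|rg_edges G|; set f := #|_|; set c := n_comp _ _; set m := n_comp _ _.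
congr (_ * _).
(* An isolated vertex contributes one face and one component, which cancel. What remains differs
   from the exponent in [flow_reciprocity] by an even number. *)
have -> : l%:Z - (f + rg_isolated G)%:Z + (c + rg_isolated G)%:Z
    = (l + (f + m) + (c + m))%:Z - ((f + m).*2)%:Z by lia.
rewrite expfzDr // exprnP.
by rewrite -exprnN -muln2 mulnC exprM sqrrN !expr1n invr1 mulr1.
Qed.
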